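(* Let $A=[a_1\ \cdots\ a_n]\in\mathbb{R}^{m\times n}$ with $\|a_i\|=1$ for $i=1,\dots,n$. If $0\in\operatorname{conv}(A)=\operatorname{conv}\{a_1,\dots,a_n\}$, then $w(A)\ge|\rho(A)|$.
   Context: $\|\cdot\|$ is the Euclidean norm and $\langle\cdot,\cdot\rangle$ the standard inner product. For $x\in\mathbb{R}^n$ with $x\ge0$ (componentwise), $S(x)=\{i:x_i>0\}$. Relative width: $$w(A)=\min_{x\ge 0,\ Ax\ne 0}\ \max_{\ell,j}\left\{\frac{\langle Ax,a_\ell-a_j\rangle}{\|Ax\|}:\ \ell\in S(x),\ j\in\{1,\dots,n\}\right\}.$$ Condition measure: $$\rho(A)=\max_{z\in\mathbb{R}^m,\ \|z\|=1}\ \min_{i=1,\dots,n}\langle a_i,z\rangle .$$ *)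

(* Defs.v *)
From mathcomp Require Import all_boot all_order all_algebra.
From mathcomp Require Import classical_sets reals.

Set Implicit Arguments.
Unset Strict Implicit.
Unset Printing Implicit Defensive.

Import Order.TTheory GRing.Theory Num.Theory.

Local Open Scope classical_set_scope.
Local Open Scope ring_scope.

Definition dot (R : realType) (m : nat) (u v : 'cV[R]_m) : R :=
  \sum_(k < m) u k 0 * v k 0.

(* The library norm on matrices is the max norm, hence a separate definition. *)
Definition enorm (R : realType) (m : nat) (u : 'cV[R]_m) : R :=
  Num.sqrt (dot u u).

(* The columns of A play the role of the points a_1, ..., a_n. *)
Definition conv_cols (R : realType) (m n : nat) (A : 'M[R]_(m, n)) :
    set 'cV[R]_m :=
  [set A *m x | x in [set x : 'cV[R]_n |
     (forall i, 0 <= x i 0) /\ \sum_(i < n) x i 0 = 1]].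

Definition supp (R : realType) (n : nat) (x : 'cV[R]_n) : set 'I_n :=
  [set i | 0 < x i 0].

(* The maxima and minima below are written with sup and inf, which agree with
   them whenever they are attained.  Here the set is finite, and nonempty when
   x >= 0 and A x <> 0. *)
Definition width_at (R : realType) (m n : nat) (A : 'M[R]_(m, n))
    (x : 'cV[R]_n) : R :=
  sup [set dot (A *m x) (col lj.1 A - col lj.2 A) / enorm (A *m x)
      | lj in supp x `*` [set: 'I_n]].

(* When A has a nonzero column, this infimum is over a nonempty set and is
   attained: along a minimizing sequence with constant support, the directions
   A x / |A x| accumulate at a point of a closed cone spanned by the same
   columns, and shrinking the support can only decrease the inner maximum. *)
Definition relative_width (R : realType) (m n : nat) (A : 'M[R]_(m, n)) : R :=
  inf [set width_at A x | x in [set x : 'cV[R]_n |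
     (forall i, 0 <= x i 0) /\ A *m x != 0]].

(* When 0 < m and 0 < n, the supremum is that of a continuous function on the
   unit sphere, hence attained. *)
Definition condition_measure (R : realType) (m n : nat) (A : 'M[R]_(m, n)) : R :=
  sup [set inf [set dot (col i A) z | i in [set: 'I_n]]
      | z in [set z : 'cV[R]_m | enorm z = 1]].

(* Main.v *)
Require Import Defs.
From mathcomp Require Import all_boot all_order all_algebra.
From mathcomp Require Import classical_sets reals.

(** For [x >= 0] with [A x <> 0], put [z = A x / |A x|].  Since
    [sum_i x_i <a_i, z> = |A x| > 0], some [l] in the support of [x] has
    [<a_l, z> > 0], so the inner maximum at [x] is at least
    [- min_j <a_j, z>], which is at least [- rho A].  Pairing a convex
    combination [A y = 0] with [z] shows [min_j <a_j, z> <= 0] for every [z],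
    so [|rho A| = - rho A]. *)

Import Order.TTheory GRing.Theory Num.Theory.

Local Open Scope classical_set_scope.
Local Open Scope ring_scope.

Section InnerProduct.
Context {R : realType} {m : nat}.
Implicit Types u v : 'cV[R]_m.

Lemma dotE u v : dot u v = (u^T *m v) 0 0.
Proof. by rewrite mxE; apply: eq_bigr => k _; rewrite mxE. Qed.

Lemma dotC u v : dot u v = dot v u.
Proof. by apply: eq_bigr => k _; rewrite mulrC. Qed.

Lemma dotBr u v w : dot u (v - w) = dot u v - dot u w.
Proof. by rewrite !dotE mulmxBr !mxE. Qed.

Lemma dotZr a u v : dot u (a *: v) = a * dot u v.
Proof. by rewrite !dotE -scalemxAr mxE. Qed.

Lemma dot_ge0 u : 0 <= dot u u.
Proof. by apply: sumr_ge0 => k _; rewrite -expr2 sqr_ge0. Qed.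

Lemma dot_gt0 u : u != 0 -> 0 < dot u u.
Proof.
move=> u0; rewrite lt_def dot_ge0 andbT; apply: contra_neq u0 => uu0.
apply/colP => k; rewrite mxE; apply/eqP; rewrite -sqrf_eq0 expr2.
have sq_ge0 i : true -> 0 <= u i 0 * u i 0 by rewrite -expr2 sqr_ge0.
by move/eqP: uu0; rewrite psumr_eq0 // => /allP/(_ k (mem_index_enum _)).
Qed.

Lemma enorm_gt0 u : u != 0 -> 0 < enorm u.
Proof. by move=> u0; rewrite sqrtr_gt0 dot_gt0. Qed.

Lemma enorm_normalize u : u != 0 -> enorm ((enorm u)^-1 *: u) = 1.
Proof.
move=> u0; have e0 := enorm_gt0 _ u0.
rewrite {1}/enorm dotZr dotC dotZr -(sqr_sqrtr (dot_ge0 u)) -/(enorm u) expr2.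
by rewrite mulKf ?gt_eqF// mulVf ?gt_eqF// sqrtr1.
Qed.

Lemma dot_mulmx {n : nat} (A : 'M[R]_(m, n)) (x : 'cV[R]_n) v :
  dot (A *m x) v = \sum_(i < n) x i 0 * dot (col i A) v.
Proof.
under eq_bigr do rewrite mulr_sumr; rewrite exchange_big /=.
apply: eq_bigr => k _; rewrite mxE mulr_suml.
by apply: eq_bigr => i _; rewrite mxE mulrCA mulrA.
Qed.

End InnerProduct.

Section FiniteImage.
Context {R : realType} {I : finType}.

Lemma has_ubound_fin_image (f : I -> R) (P : set I) :
  has_ubound [set f i | i in P].
Proof.
exists (\sum_i `|f i|) => _ [i _ <-].
by rewrite (bigD1 i) //= ler_wpDr ?sumr_ge0 // ler_norm.
Qed.

Lemma has_lbound_fin_image (f : I -> R) (P : set I) :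
  has_lbound [set f i | i in P].
Proof.
exists (- \sum_i `|f i|) => _ [i _ <-].
by rewrite lerNl (bigD1 i) //= ler_wpDr ?sumr_ge0 // -normrN ler_norm.
Qed.

(** The point [i0] only witnesses that the index type is inhabited; over an empty type [inf] would
    be the default 0 and no [j] could exist. *)
Lemma fin_image_inf_attained (f : I -> R) (i0 : I) :
  exists j, f j = inf [set f i | i in [set: I]].
Proof.
case: (@arg_minP _ _ _ i0 predT f isT) => j _ jmin; exists j.
apply/eqP; rewrite eq_le; apply/andP; split.
  by apply: lb_le_inf; [exists (f j), j | move=> _ [i _ <-]; exact: jmin].
by apply: ge_inf; [exact: has_lbound_fin_image | exists j].
Qed.

End FiniteImage.

Section ZeroInHull.
Context {R : realType} {m n : nat} (A : 'M[R]_(m, n)).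
Hypothesis conv0 : conv_cols A 0.

Lemma conv0_min_le0 (z : 'cV[R]_m) :
  inf [set dot (col i A) z | i in [set: 'I_n]] <= 0.
Proof.
have [y [y0 y1] Ay0] := conv0; rewrite leNgt; apply/negP => c0.
set c := inf _ in c0.
suff : c <= dot (A *m y) z.
  by rewrite Ay0 dotE trmx0 mul0mx mxE leNgt c0.
(* Writing [c] as the sum of the [y i 0 * c] reduces the bound to a termwise comparison. *)
rewrite dot_mulmx -[c]mul1r -y1 mulr_suml; apply: ler_sum => i _.
apply: ler_wpM2l => //; apply: ge_inf; first exact: has_lbound_fin_image.
by exists i.
Qed.

(** A [sup] dominates its set only when that set is bounded above; [conv0] supplies the bound 0. *)
Lemma condition_measure_ge_min (z : 'cV[R]_m) : enorm z = 1 ->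
  inf [set dot (col i A) z | i in [set: 'I_n]] <= condition_measure A.
Proof.
move=> z1; apply: ub_le_sup; last by exists z.
by exists 0 => _ [v _ <-]; exact: conv0_min_le0.
Qed.

Lemma condition_measure_le0 : condition_measure A <= 0.
Proof.
rewrite /condition_measure; set E := (X in sup X).
(* With no unit vectors, as when [m = 0], the supremum takes its default value 0. *)
have [->|/set0P E0] := eqVneq E set0; first by rewrite sup0.
by apply: ge_sup => // _ [v _ <-]; exact: conv0_min_le0.
Qed.

Lemma width_at_ge (x : 'cV[R]_n) : (forall i, 0 <= x i 0) -> A *m x != 0 ->
  - condition_measure A <= width_at A x.
Proof.
move=> x0 Ax0; have e0 := enorm_gt0 _ Ax0.
set z := (enorm (A *m x))^-1 *: (A *m x).
have z1 : enorm z = 1 by exact: enorm_normalize.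
have [l xl zl] : exists2 l, 0 < x l 0 & 0 < dot (col l A) z.
  have : 0 < dot (A *m x) z by rewrite dotZr mulr_gt0 ?invr_gt0 ?dot_gt0.
  rewrite dot_mulmx; have [/existsP[l /andP[xl zl _]]|/existsPn no] :=
    boolP [exists l, (0 < x l 0) && (0 < dot (col l A) z)]; first by exists l.
  (* Without such an [l] no term of the positive sum is positive: either [x i 0] vanishes or its
     cofactor is at most 0. *)
  rewrite ltNge sumr_le0 // => i _; move: (no i); rewrite negb_and -!leNgt.
  case/orP => [xi|]; last exact: mulr_ge0_le0.
  by rewrite (le_anti (introT andP (conj xi (x0 i)))) mul0r.
have [j jmin] := fin_image_inf_attained (fun i => dot (col i A) z) l.
apply: (@le_trans _ _ (dot (A *m x) (col l A - col j A) / enorm (A *m x))).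
  rewrite mulrC dotC -dotZr -/z dotC dotBr !(dotC z) jmin.
  rewrite addrC ler_wpDr ?(ltW zl) // lerN2.
  exact: condition_measure_ge_min.
apply: ub_le_sup; first exact: has_ubound_fin_image.
by exists (l, j).
Qed.

End ZeroInHull.

Theorem proposition1 (R : realType) (m n : nat) (A : 'M[R]_(m, n))
    (unit_cols : forall i : 'I_n, enorm (col i A) = 1)
    (conv0 : conv_cols A 0) :
  `|condition_measure A| <= relative_width A.
Proof.
rewrite ler0_norm ?condition_measure_le0 //.
(* A lower bound passes to [inf] only for a nonempty set, so an admissible [x] must still be
   exhibited. *)
apply: lb_le_inf; last by move=> _ [x [x0 Ax0] <-]; exact: width_at_ge.
have [y [_ y1] _] := conv0.
(* The weights [y] sum to 1 while an empty sum is 0, so [n] is positive. *)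
have [i _] : exists i : 'I_n, true.
  case: n A unit_cols conv0 y y1 => [|k] ? ? ? ? y1; last by exists ord0.
  by move: y1; rewrite big_ord0 => /esym/eqP; rewrite oner_eq0.
(* A basis vector is admissible: [A] sends it to a column of norm 1, hence nonzero. *)
exists (width_at A (delta_mx i 0)), (delta_mx i 0) => //.
split=> [k|]; first by rewrite mxE ler0n.
rewrite -colE; apply/eqP => Ai0; move: (unit_cols i).
by rewrite Ai0 /enorm dotE mulmx0 mxE sqrtr0 => /esym/eqP; rewrite oner_eq0.
Qed.
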